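(* Let $f$ satisfy Assumption A with constant $b>0$, let $(\chi_n)_{n\ge 1}$ satisfy Assumption B, let $x^*\in (f(0),f(b))$ be an arbitrary point, let $\nu=\nu(x^* )=\Phi(f^{-1}(x^* ))$, let $x_0>0$, and let $\ell\in\mathbb R$ satisfy $$0<\ell<\min\{\Phi(b)-\nu,\ \nu-\Phi(0)\}.$$ Let $(x_n)$ be the solution of $$x_{n+1}=f\big((\nu+\ell\chi_{n+1})x_n\big),\qquad n=0,1,2,\dots,$$ with initial value $x_0$. Then the following hold almost surely. (i) For each $\delta>0$ there exists a nonrandom $N=N(\delta)\in\mathbb N$ such that, for all $n\ge N$, $$x_n\in\left(\frac{\Phi^{-1}(\nu-\ell)}{\nu+\ell}-\delta,\ \frac{\Phi^{-1}(\nu+\ell)}{\nu-\ell}+\delta\right).$$ (ii) $$\liminf_{n\to\infty}x_n\ge\frac{\Phi^{-1}(\nu-\ell)}{\nu+\ell},\qquad \limsup_{n\to\infty}x_n\le\frac{\Phi^{-1}(\nu+\ell)}{\nu-\ell}.$$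
   Context: Assumption A (on $f$ and $b$): $f:[0,\infty)\to[0,\infty)$ is continuous, and $b>0$ is a real number such that $f$ is strictly increasing on $(0,b]$, $f(x)/x$ is strictly decreasing on $(0,b]$, $f(b)>b$, and $f(b)/b>f(x)/x$ for all $x\in(b,\infty)$. Assumption B (on the noise): on a complete probability space, $(\chi_n)_{n\ge1}$ is a sequence of independent identically distributed random variables with zero mean, having a density $\phi$ with $\phi(x)>0$ for $x\in[-1,1]$ and $\phi(x)=0$ for $x\notin[-1,1]$. Notation: $f^{-1}:[f(0),f(b)]\to[0,b]$ is the inverse of the restriction of $f$ to $[0,b]$. $\Phi(z):=z/f(z)$ for $z\in(0,b]$, and $\Phi(0):=\lim_{x\to0^+}x/f(x)$ (so $\Phi(0)=0$ if $\lim_{x\to0^+}f(x)/x=\infty$). $\Phi$ is strictly increasing and continuous, $0\le\Phi(0)<\Phi(b)<1$, and $\Phi^{-1}:(\Phi(0),\Phi(b))\to(0,b)$ denotes its inverse on $(0,b)$.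
   Formalization: Added assumption: if f(0)=0 then f(x)>0 for all x>b. Without it the claim fails: b=1, f=2√x on [0,1], 2(2−x) on [1,2], 0 beyond, x*=1, ℓ=1/8, x_0=16 gives x_n=0 for all n≥1, below the positive lower bound 1/6. *)

(* Defs.v *)
From HB Require Import structures.
From mathcomp Require Import all_boot all_order all_algebra.
From mathcomp Require Import all_classical all_reals all_analysis.
Import Order.TTheory GRing.Theory Num.Theory.
Import numFieldNormedType.Exports.

Set Implicit Arguments.
Unset Strict Implicit.
Unset Printing Implicit Defensive.

Local Open Scope classical_set_scope.
Local Open Scope ring_scope.

(* A function [0, oo) -> [0, oo) is represented by f : R -> R of which only the
   values on [0, oo) are constrained. *)
Record map_assumption (R : realType) (f : R -> R) (b : R) : Prop := {
  map_nonneg : forall x, 0 <= x -> 0 <= f x;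
  map_continuous : {within `[0, +oo[, continuous f};
  map_b_gt0 : 0 < b;
  map_increasing : {in `]0, b] &, forall x y, x < y -> f x < f y};
  map_ratio_decreasing :
    {in `]0, b] &, forall x y, x < y -> f y / y < f x / x};
  map_above_b : b < f b;
  map_ratio_tail : forall x, b < x -> f x / x < f b / b }.

Definition mutually_independent (R : realType) (d : measure_display)
    (T : measurableType d) (P : probability T R) (X : nat -> {RV P >-> R}) :
    Prop :=
  forall (s : seq nat) (A : nat -> set R), uniq s ->
    (forall i, i \in s -> measurable (A i)) ->
    P (\bigcap_(i in [set` s]) X i @^-1` A i) =
    (\prod_(i <- s) P (X i @^-1` A i))%E.

Definition has_density (R : realType) (d : measure_display)
    (T : measurableType d) (P : probability T R) (X : {RV P >-> R})
    (phi : R -> R) : Prop :=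
  [/\ measurable_fun setT phi, forall x, 0 <= phi x &
      forall A, measurable A ->
        distribution P X A = (\int[lebesgue_measure]_(x in A) (phi x)%:E)%E].

(* The noise is chi_1, chi_2, ...: the term chi 0 is unconstrained and is never
   used. *)
Record noise_assumption (R : realType) (d : measure_display)
    (T : measurableType d) (P : probability T R) (chi : nat -> {RV P >-> R})
    (phi : R -> R) : Prop := {
  noise_complete : measure_is_complete P;
  noise_independent : mutually_independent (fun n => chi n.+1);
  noise_identical : forall m n (A : set R), measurable A ->
    distribution P (chi m.+1) A = distribution P (chi n.+1) A;
  noise_mean0 : forall n, ('E_P[chi n.+1] = 0)%E;
  noise_density : forall n, has_density (chi n.+1) phi;
  noise_density_pos : forall x, x \in `[-1, 1] -> 0 < phi x;
  noise_density_out : forall x, x \notin `[-1, 1] -> phi x = 0 }.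

(* pinv A g is the inverse of g restricted to A, meaningful on g @` A. *)
Definition f_inv (R : realType) (f : R -> R) (b : R) : R -> R := pinv `[0, b] f.

Definition Phi (R : realType) (f : R -> R) (z : R) : R :=
  if z == 0 then lim (x / f x @[x --> 0^'+]) else z / f z.

Definition Phi_inv (R : realType) (f : R -> R) (b : R) : R -> R :=
  pinv `]0, b[ (Phi f).

(* Pathwise solution: the noise value chi n.+1 w drives the step n -> n.+1. *)
Fixpoint pf_solution (R : realType) (T : Type) (f : R -> R) (nu ell : R)
    (chi : nat -> T -> R) (x0 : R) (n : nat) (w : T) : R :=
  if n is m.+1 then f ((nu + ell * chi m.+1 w) * pf_solution f nu ell chi x0 m w)
  else x0.

(* Main.v *)
(* Almost surely every noise value lies in [-1, 1], so the statement is about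
   orbits x' = f (a x) with arbitrary a in [A, B] = [nu - ell, nu + ell], and
   all bounds can be made uniform in the choice of the multipliers a.
   Let u = Phi_inv B.  For w slightly above u, a step either lands below w / B
   (if a x <= w) or contracts by the factor B f(w) / w < 1 (if a x > w).  Hence
   after a uniform time x <= w / B, which is below u / A and keeps a x inside
   (0, b], where f is increasing.  From then on x' >= f (A x), and below
   Phi_inv A / B this is a uniform expansion, so x passes that level after a
   uniform time, provided that it starts from a uniform positive bound.  Since
   the true limiting bounds u / B and Phi_inv A / A are strictly better than the
   stated ones, the time does not even depend on delta. *)
Require Import Defs.
From mathcomp Require Import all_boot all_order all_algebra.
From mathcomp Require Import all_classical all_reals all_analysis.
From mathcomp Require Import ring lra.

Import Order.TTheory GRing.Theory Num.Theory.
Import numFieldNormedType.Exports.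

Set Implicit Arguments.
Unset Strict Implicit.
Unset Printing Implicit Defensive.

Local Open Scope classical_set_scope.
Local Open Scope ring_scope.

(** * Geometric decay, and monotonicity of f and of f(x)/x up to b *)

Lemma exists_expr_mul_le (R : realType) (r c e : R) :
  0 <= r -> r < 1 -> 0 < e -> exists n, r ^+ n * c <= e.
Proof.
move=> r0 r1 e0.
have : (r ^+ n * c) @[n --> \oo] --> 0.
  rewrite -(mul0r c); apply: cvgMl; apply: cvg_expr.
  by rewrite ger0_norm.
move=> /cvgr_le /(_ e e0) [n _ /(_ n (leqnn n))] h.
by exists n.
Qed.

Lemma map_pos (R : realType) (f : R -> R) (b x : R) :
  map_assumption f b -> 0 < x -> x <= b -> 0 < f x.
Proof.
move=> Hf x0 xb; apply: (@le_lt_trans _ _ (f (x / 2))).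
  by apply: (map_nonneg Hf); lra.
by apply: (map_increasing Hf); rewrite ?in_itv /=; lra.
Qed.

Lemma map_continuous_segment (R : realType) (f : R -> R) (b u v : R) :
  map_assumption f b -> 0 <= u -> {within `[u, v], continuous f}.
Proof.
move=> Hf u0; apply: continuous_subspaceW (map_continuous Hf) => x /=.
by rewrite !in_itv /= andbT => /andP[ux _]; exact: le_trans ux.
Qed.

(** Strict monotonicity is assumed only on (0, b]. The endpoint 0 is reached through right
    continuity, f 0 being the limit of f t <= f y as t decreases to 0. *)
Lemma map_le (R : realType) (f : R -> R) (b x y : R) :
  map_assumption f b -> 0 <= x -> x <= y -> y <= b -> f x <= f y.
Proof.
move=> Hf; rewrite le_eqVlt => /predU1P[<-|x0] xy yb; last first.
  move: xy; rewrite le_eqVlt => /predU1P[->//|xy].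
  by apply/ltW/(map_increasing Hf); rewrite ?in_itv /=; lra.
move: xy; rewrite le_eqVlt => /predU1P[->//|y0].
have /(continuous_within_itvP _ y0)[_ f0 _] :=
  map_continuous_segment (v := y) Hf (lexx 0).
rewrite -(cvg_lim _ f0)//.
apply: limr_le; first by apply/cvg_ex; exists (f 0).
near=> t; apply/ltW/(map_increasing Hf); rewrite ?in_itv /=.
- apply/andP; split; first by near: t; exact: nbhs_right_gt.
  by apply: le_trans yb; near: t; exact: nbhs_right_le.
- by rewrite y0.
- by near: t; exact: nbhs_right_lt.
Unshelve. all: by end_near. Qed.

Lemma map_ratio_le (R : realType) (f : R -> R) (b w y : R) :
  map_assumption f b -> 0 < w -> w <= b -> w <= y -> f y / y <= f w / w.
Proof.
move=> Hf w0 wb wy.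
have ratio_le u v : 0 < u -> u <= v -> v <= b -> f v / v <= f u / u.
  move=> u0 uv vb; move: uv; rewrite le_eqVlt => /predU1P[->//|uv].
  by apply/ltW/(map_ratio_decreasing Hf); rewrite ?in_itv /=; lra.
have [yb|yb] := leP y b; first exact: ratio_le.
by apply: le_trans (ltW (map_ratio_tail Hf yb)) _; exact: ratio_le.
Qed.

(** * The function Phi, its value at 0 and its inverse *)

Lemma PhiE (R : realType) (f : R -> R) (z : R) : 0 < z -> Phi f z = z / f z.
Proof. by move=> z0; rewrite /Phi gt_eqF. Qed.

Lemma Phi_lt (R : realType) (f : R -> R) (b x y : R) :
  map_assumption f b -> 0 < x -> x < y -> y <= b -> Phi f x < Phi f y.
Proof.
move=> Hf x0 xy yb.
have y0 := lt_trans x0 xy.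
have fx := map_pos Hf x0 (ltW (lt_le_trans xy yb)).
have fy := map_pos Hf y0 yb.
rewrite !PhiE// -[x / _]invf_div -[y / _]invf_div ltf_pV2 ?posrE ?divr_gt0//.
by apply: (map_ratio_decreasing Hf); rewrite ?in_itv /=; lra.
Qed.

(** Near 0 the quotient z / f z is increasing and bounded below by 0, so the [lim] in [Phi] is a
    genuine limit and not a default value. *)
Lemma Phi_cvg0 (R : realType) (f : R -> R) (b : R) :
  map_assumption f b -> z / f z @[z --> 0^'+] --> Phi f 0.
Proof.
move=> Hf; rewrite /Phi eqxx.
have b0 := map_b_gt0 Hf.
have in0b z : z \in `]0, b[ -> 0 < z /\ z < b.
  by rewrite in_itv => /andP.
apply/cvg_ex; eexists; apply: (@nondecreasing_at_right_cvgr _ _ _ (BLeft b)).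
- by rewrite bnd_simp.
- move=> x y /in0b[x0 xb] /in0b[y0 yb].
  rewrite le_eqVlt => /predU1P[->//|xy].
  by rewrite -!PhiE//; apply/ltW/(Phi_lt Hf) => //; exact: ltW.
- exists 0 => _ [z /in0b[z0 zb] <-].
  by apply: divr_ge0; [exact: ltW|exact/(map_nonneg Hf)/ltW].
Qed.

Lemma Phi0_ge0 (R : realType) (f : R -> R) (b : R) :
  map_assumption f b -> 0 <= Phi f 0.
Proof.
move=> Hf; have h := Phi_cvg0 Hf; rewrite -(cvg_lim _ h)//.
apply: limr_ge; first by apply/cvg_ex; exists (Phi f 0).
near=> z; have z0 : 0 < z by near: z; exact: nbhs_right_gt.
by apply: divr_ge0; [exact: ltW|exact/(map_nonneg Hf)/ltW].
Unshelve. all: by end_near. Qed.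

Lemma Phi_inv_spec (R : realType) (f : R -> R) (b a : R) :
  map_assumption f b -> Phi f 0 < a -> a < Phi f b ->
  [/\ 0 < Phi_inv f b a, Phi_inv f b a < b & Phi f (Phi_inv f b a) = a].
Proof.
move=> Hf a0 ab; have b0 := map_b_gt0 Hf.
(* The left end u must be positive: when f 0 = 0, the point 0 is itself a zero of z - a * f z, the
   function used below. *)
have [u [u0 ub ua]] : exists u, [/\ 0 < u, u < b & Phi f u < a].
  have h : \forall z \near 0^'+, z / f z < a.
    by have /cvgr_lt := Phi_cvg0 Hf; exact.
  near (0 : R)^'+ => u; have u0 : 0 < u by near: u; exact: nbhs_right_gt.
  have ub : u < b by near: u; exact: nbhs_right_lt.
  have ua : u / f u < a by near: u.
  by exists u; rewrite PhiE.
have fu := map_pos Hf u0 (ltW ub).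
have fb := map_pos Hf b0 (lexx b).
have cont : {within `[u, b], continuous (fun z => z - a * f z)}.
  move=> z; apply: cvgB.
    by apply: continuous_subspaceT => ?; exact: cvg_id.
  apply: cvgMr; exact: (map_continuous_segment (v := b) Hf (ltW u0)).
have lu : u - a * f u <= 0.
  by move: ua; rewrite PhiE// ltr_pdivrMr// => /ltW; rewrite subr_le0.
have lb : 0 <= b - a * f b.
  by move: ab; rewrite PhiE// ltr_pdivlMr// => /ltW; rewrite subr_ge0.
have [|c] := IVT (v := 0) (ltW ub) cont.
  by rewrite min_l ?max_r ?lu ?lb//; exact: le_trans lb.
rewrite in_itv /= => /andP[uc cb].
have c0 := lt_le_trans u0 uc.
move=> /eqP; rewrite subr_eq0 => /eqP ca.
have fc := map_pos Hf c0 cb.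
have Pc : Phi f c = a by rewrite PhiE// {1}ca mulfK// gt_eqF.
have {cb}cb : c < b.
  by rewrite lt_neqAle cb andbT; apply: contraTneq ab => <-; rewrite Pc ltxx.
(* Strict monotonicity makes [Phi f] injective on (0, b), so [pinv] can only return c. *)
suff -> : Phi_inv f b a = c by [].
rewrite -Pc /Phi_inv pinvKV//; last by rewrite inE /= in_itv /= c0.
move=> x y; rewrite !inE /= !in_itv /= => /andP[x0 xb] /andP[y0 yb] Pxy.
have [xy|yx|//] := ltgtP x y.
- by have := Phi_lt Hf x0 xy (ltW yb); rewrite Pxy ltxx.
- by have := Phi_lt Hf y0 yx (ltW xb); rewrite Pxy ltxx.
Unshelve. all: by end_near. Qed.

(** * Deterministic orbits with arbitrary multipliers in [A, B] *)

Definition perturbed_orbit (R : realType) (f : R -> R) (A B : R)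
    (x : nat -> R) : Prop :=
  forall n, exists2 a, A <= a <= B & x n.+1 = f (a * x n).

(** If a x <= w, monotonicity gives f (a x) <= f w <= w / B. Otherwise f y / y <= f w / w at y = a
    x, even when y lies beyond b. *)
Lemma upper_step (R : realType) (f : R -> R) (b A B w a x : R) :
  map_assumption f b -> 0 < A -> A <= a -> a <= B -> 0 < w -> w <= b ->
  B * f w <= w -> 0 <= x ->
  f (a * x) <= Num.max (w / B) (B * f w / w * x).
Proof.
move=> Hf A0 Aa aB w0 wb Bw x0.
have B0 : 0 < B by lra.
have a0 : 0 < a by lra.
rewrite le_max; have [yw|wy] := leP (a * x) w; apply/orP; [left|right].
  rewrite ler_pdivlMr// mulrC; apply: le_trans Bw.
  by rewrite ler_pM2l//; apply: (map_le Hf) => //; rewrite mulr_ge0// ltW.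
have y0 : 0 < a * x by exact: lt_trans wy.
have := map_ratio_le Hf w0 wb (ltW wy).
rewrite ler_pdivrMr// => /le_trans; apply.
have -> : B * f w / w * x = f w / w * (B * x) by rewrite [B * f w]mulrC; ring.
apply: ler_wpM2l; last exact: ler_wpM2r.
by rewrite divr_ge0 ?(ltW w0)// ltW// (map_pos Hf).
Qed.

(** Keeping B x <= b lets a be replaced by A. For x < l the ratio of f at A x is at least the one at
    A l, which gives the linear growth factor. *)
Lemma lower_step (R : realType) (f : R -> R) (b A B l a x : R) :
  map_assumption f b -> 0 < A -> A <= a -> a <= B -> 0 < l -> A * l <= b ->
  l <= f (A * l) -> 0 <= x -> B * x <= b ->
  Num.min l (f (A * l) / l * x) <= f (a * x).
Proof.
move=> Hf A0 Aa aB l0 Alb lf x0 Bxb.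
have B0 : 0 < B by lra.
have Ax0 : 0 <= A * x by rewrite mulr_ge0// ltW.
have axB : a * x <= b by apply: le_trans Bxb; rewrite ler_wpM2r.
have fAx : f (A * x) <= f (a * x) by apply: (map_le Hf) => //; rewrite ler_wpM2r.
rewrite ge_min; have [lx|xl] := leP l x; apply/orP; [left|right].
  apply: (le_trans lf); apply: (map_le Hf) => //.
    by rewrite mulr_ge0// ltW.
  by apply: le_trans (_ : A * x <= _); rewrite ?ler_pM2l// ler_wpM2r.
apply: le_trans fAx.
move: x0; rewrite le_eqVlt => /predU1P[<-|x0].
  by rewrite !mulr0; exact: (map_nonneg Hf).
have Axl : A * x <= A * l by rewrite ler_pM2l// ltW.
have := map_ratio_le Hf (mulr_gt0 A0 x0) (le_trans Axl Alb) Axl.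
rewrite ler_pdivlMr ?mulr_gt0//.
suff -> : f (A * l) / (A * l) * (A * x) = f (A * l) / l * x by [].
by field; rewrite !gt_eqF.
Qed.

Lemma orbit_ge0 (R : realType) (f : R -> R) (b A B : R) (x : nat -> R) :
  map_assumption f b -> 0 < A -> perturbed_orbit f A B x -> 0 <= x 0%N ->
  forall n, 0 <= x n.
Proof.
move=> Hf A0 Ox x0; elim=> // n IH.
have [a /andP[Aa _] ->] := Ox n.
by apply/(map_nonneg Hf)/mulr_ge0 => //; lra.
Qed.

(** The first bound covers the transient as well; it is the constant K that the compactness argument
    for positive lower bounds requires. *)
Lemma orbit_eventually_le (R : realType) (f : R -> R) (b A B w x0 : R) :
  map_assumption f b -> 0 < A -> A <= B -> 0 < w -> w <= b -> B * f w < w ->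
  0 <= x0 ->
  (forall x, perturbed_orbit f A B x -> x 0%N = x0 ->
    forall n, x n <= Num.max (w / B) x0) /\
  exists N, forall x, perturbed_orbit f A B x -> x 0%N = x0 ->
    forall n, (N <= n)%N -> x n <= w / B.
Proof.
move=> Hf A0 AB w0 wb Bw x00.
have B0 : 0 < B by lra.
have wB0 : 0 < w / B by rewrite divr_gt0.
set r := B * f w / w.
have r0 : 0 <= r.
  by rewrite divr_ge0 ?mulr_ge0 ?(ltW B0) ?(ltW w0)// ltW// (map_pos Hf).
have r1 : r < 1 by rewrite ltr_pdivrMr// mul1r.
have step x n : perturbed_orbit f A B x -> x 0%N = x0 ->
    x n.+1 <= Num.max (w / B) (r * x n).
  move=> Ox xx0; have [a /andP[Aa aB] ->] := Ox n.
  apply: (upper_step Hf A0) => //; first exact: ltW.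
  by apply: (orbit_ge0 Hf A0 Ox); rewrite xx0.
have decay x n : perturbed_orbit f A B x -> x 0%N = x0 ->
    x n <= Num.max (w / B) (r ^+ n * x0).
  move=> Ox xx0; elim: n => [|n IH].
    by rewrite expr0 mul1r xx0 le_max lexx orbT.
  apply: le_trans (step _ _ Ox xx0) _; rewrite ge_max le_max lexx /=.
  have : r * x n <= r * Num.max (w / B) (r ^+ n * x0) by rewrite ler_wpM2l.
  move=> /le_trans; apply.
  rewrite maxr_pMr// ge_max !le_max exprS -mulrA lexx orbT andbT.
  by rewrite ler_piMl ?(ltW wB0) ?(ltW r1).
split=> [x Ox xx0 n|].
  apply: le_trans (decay _ _ Ox xx0) _; rewrite ge_max !le_max lexx /=.
  by rewrite ler_piMl ?orbT// exprn_ile1// ltW.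
have [N hN] := exists_expr_mul_le x0 r0 r1 wB0.
exists N => x Ox xx0 n /subnK <-; elim: (n - N)%N => [|k IH].
  by apply: le_trans (decay _ _ Ox xx0) _; rewrite ge_max lexx.
rewrite addSn; apply: le_trans (step _ _ Ox xx0) _; rewrite ge_max lexx /=.
by apply: le_trans IH; rewrite ler_piMl ?(ltW r1)// (orbit_ge0 Hf A0 Ox)// xx0.
Qed.

(** Induction by compactness: a * x n stays in [A c, B K], where f attains a positive minimum. The
    bound may shrink with n, so it serves only to start the expansion at one fixed time. *)
Lemma orbit_pos_bound (R : realType) (f : R -> R) (b A B K x0 : R) :
  map_assumption f b -> (forall y, 0 < y -> 0 < f y) -> 0 < A -> A <= B ->
  0 < x0 -> x0 <= K ->
  (forall x, perturbed_orbit f A B x -> x 0%N = x0 -> forall n, x n <= K) ->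
  forall n, exists2 c, 0 < c &
    forall x, perturbed_orbit f A B x -> x 0%N = x0 -> c <= x n.
Proof.
move=> Hf fpos A0 AB x00 x0K xK n.
(* The added condition c <= K keeps [A c, B K] nonempty in the induction step. *)
suff [c /andP[c0 _] hc] : exists2 c, 0 < c <= K &
    forall x, perturbed_orbit f A B x -> x 0%N = x0 -> c <= x n by exists c.
elim: n => [|n [c /andP[c0 cK] IH]].
  by exists x0 => [|x _ ->//]; rewrite x00.
have K0 : 0 < K by exact: lt_le_trans x0K.
have Ac0 : 0 < A * c by rewrite mulr_gt0.
have AcBK : A * c <= B * K by rewrite ler_pM// ltW.
have [m /= + hm] := EVT_min AcBK (map_continuous_segment Hf (ltW Ac0)).
rewrite in_itv /= => /andP[Acm _].
exists (Num.min (f m) K).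
  by rewrite lt_min K0 fpos ?ge_min ?lexx ?orbT// (lt_le_trans Ac0).
move=> x Ox xx0; have [a /andP[Aa aB] ->] := Ox n.
rewrite ge_min hm// in_itv /=; apply/andP; split.
  by rewrite ler_pM ?(ltW A0) ?(ltW c0)// IH.
have cx := IH _ Ox xx0.
by rewrite ler_pM ?xK//; lra.
Qed.

Lemma orbit_eventually_pos_bound (R : realType) (f : R -> R) (b A B K x0 : R)
    (N : nat) :
  map_assumption f b -> (f 0 = 0 -> forall y, b < y -> 0 < f y) ->
  0 < A -> A <= B -> 0 < x0 -> x0 <= K ->
  (forall x, perturbed_orbit f A B x -> x 0%N = x0 -> forall n, x n <= K) ->
  (forall x, perturbed_orbit f A B x -> x 0%N = x0 ->
    forall n, (N <= n)%N -> B * x n <= b) ->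
  exists2 c, 0 < c &
    forall x, perturbed_orbit f A B x -> x 0%N = x0 -> c <= x N.+1.
Proof.
move=> Hf fpos A0 AB x00 x0K xK xN.
have f00 := map_nonneg Hf (lexx 0).
(* If f 0 > 0, then f 0 is itself a lower bound one step after time N, once a * x N lies in
   [0, b]. *)
have [f0|f0] := eqVneq (f 0) 0.
  apply: (orbit_pos_bound Hf _ A0 AB x00 x0K xK) => y y0.
  by have [yb|] := leP y b; [exact: map_pos Hf y0 yb|exact: fpos].
exists (f 0) => [|x Ox xx0]; first by rewrite lt_neqAle eq_sym f0.
have [a /andP[Aa aB] ->] := Ox N.
have xN0 : 0 <= x N by apply: (orbit_ge0 Hf A0 Ox); rewrite xx0 ltW.
apply: (map_le Hf) => //; first by rewrite mulr_ge0//; lra.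
by apply: le_trans (xN _ Ox xx0 _ (leqnn N)); rewrite ler_wpM2r.
Qed.

Lemma orbit_eventually_ge (R : realType) (f : R -> R) (b A B l c x0 : R)
    (N : nat) :
  map_assumption f b -> 0 < A -> A <= B -> 0 < l -> A * l <= b ->
  l < f (A * l) -> 0 < c -> 0 <= x0 ->
  (forall x, perturbed_orbit f A B x -> x 0%N = x0 ->
    forall n, (N <= n)%N -> B * x n <= b) ->
  (forall x, perturbed_orbit f A B x -> x 0%N = x0 -> c <= x N) ->
  exists M, forall x, perturbed_orbit f A B x -> x 0%N = x0 ->
    forall n, (M <= n)%N -> l <= x n.
Proof.
move=> Hf A0 AB l0 Alb lf c0 x00 xb xc.
set q := f (A * l) / l.
have q1 : 1 < q by rewrite ltr_pdivlMr// mul1r.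
have q0 : 0 < q by lra.
have step x n : perturbed_orbit f A B x -> x 0%N = x0 -> (N <= n)%N ->
    Num.min l (q * x n) <= x n.+1.
  move=> Ox xx0 Nn; have [a /andP[Aa aB] ->] := Ox n.
  apply: (lower_step Hf A0 Aa aB) => //; first exact: ltW.
    by apply: (orbit_ge0 Hf A0 Ox); rewrite xx0.
  exact: xb.
have growth x k : perturbed_orbit f A B x -> x 0%N = x0 ->
    Num.min l (q ^+ k * c) <= x (k + N)%N.
  move=> Ox xx0; elim: k => [|k IH].
    by rewrite expr0 mul1r ge_min xc// orbT.
  rewrite addSn; apply: le_trans (step _ _ Ox xx0 (leq_addl _ _)).
  rewrite le_min ge_min lexx /=.
  have : q * Num.min l (q ^+ k * c) <= q * x (k + N)%N by rewrite ler_pM2l.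
  apply: le_trans.
  rewrite minr_pMr ?(ltW q0)// le_min !ge_min exprS -mulrA lexx orbT andbT.
  by rewrite ler_peMl// ltW.
have qV0 : 0 <= q^-1 by rewrite invr_ge0 ltW.
have qV1 : q^-1 < 1 by rewrite invf_lt1.
(* Decay of q^-k l below c is the same as l <= q^k c. *)
have [k] := exists_expr_mul_le l qV0 qV1 c0.
rewrite exprVn mulrC ler_pdivrMr ?exprn_gt0// mulrC => lk.
exists (k + N)%N => x Ox xx0 n /subnK <-; elim: (n - _)%N => [|j IH].
  by apply: le_trans (growth _ k Ox xx0); rewrite le_min lexx.
rewrite addSn.
have := step x (j + (k + N))%N Ox xx0; rewrite addnA leq_addl -addnA => /(_ isT).
apply: le_trans; rewrite le_min lexx /=; apply: (le_trans IH).
by rewrite ler_peMl ?(ltW q1)// (le_trans (ltW l0)).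
Qed.

Lemma orbit_eventually_in (R : realType) (f : R -> R) (b A B x0 : R) :
  map_assumption f b -> (f 0 = 0 -> forall y, b < y -> 0 < f y) ->
  Phi f 0 < A -> A < B -> B < Phi f b -> 0 < x0 ->
  exists N, forall x, perturbed_orbit f A B x -> x 0%N = x0 ->
    forall n, (N <= n)%N ->
      Phi_inv f b A / B <= x n <= Phi_inv f b B / A.
Proof.
move=> Hf fpos PA AB BP x00.
have A0 : 0 < A by exact: le_lt_trans (Phi0_ge0 Hf) PA.
have B0 : 0 < B by lra.
have [] := Phi_inv_spec Hf PA (lt_trans AB BP).
set l := Phi_inv f b A => l0 lb Pl.
have [] := Phi_inv_spec Hf (lt_trans PA AB) BP.
set u := Phi_inv f b B => u0 ub Pu.
(* Any w in (u, b] with w / B <= u / A serves. Since A < B, the value B u / A exceeds u. *)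
pose w := Num.min (B * (u / A)) b.
have wb : w <= b by rewrite ge_min lexx orbT.
have uw : u < w.
  by rewrite lt_min ub andbT mulrCA ltr_pMr// ltr_pdivlMr// mul1r.
have w0 := lt_trans u0 uw.
have Bw : B * f w < w.
  have := Phi_lt Hf u0 uw wb; rewrite Pu PhiE// ltr_pdivlMr//.
  exact: map_pos Hf w0 wb.
have [xK [N xN]] := orbit_eventually_le Hf A0 (ltW AB) w0 wb Bw (ltW x00).
have xb x : perturbed_orbit f A B x -> x 0%N = x0 ->
    forall n, (N <= n)%N -> B * x n <= b.
  move=> Ox xx0 n Nn; apply: le_trans wb.
  by rewrite mulrC -ler_pdivlMr// xN.
have [|c c0 xc] := orbit_eventually_pos_bound Hf fpos A0 (ltW AB) x00 _ xK xb.
  by rewrite le_max lexx orbT.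
have lB0 : 0 < l / B by rewrite divr_gt0.
have AlB0 : 0 < A * (l / B) by rewrite mulr_gt0.
have AlBl : A * (l / B) < l.
  by rewrite mulrCA gtr_pMr// ltr_pdivrMr// mul1r.
have AlBb := lt_trans AlBl lb.
(* With y = l / B, A y < l gives Phi (A y) < Phi l = A, that is, y < f (A y). *)
have lf : l / B < f (A * (l / B)).
  have := Phi_lt Hf AlB0 AlBl (ltW lb); rewrite Pl PhiE//.
  by rewrite ltr_pdivrMr ?(map_pos Hf) ?(ltW AlBb)// ltr_pM2l.
have [|M xM] := orbit_eventually_ge (N := N.+1) Hf A0 (ltW AB) lB0 (ltW AlBb)
  lf c0 (ltW x00) _ xc.
  by move=> x Ox xx0 n Nn; apply: xb => //; exact: ltnW.
exists (maxn M N) => x Ox xx0 n; rewrite geq_max => /andP[Mn Nn].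
rewrite xM//=; apply: le_trans (xN _ Ox xx0 _ Nn) _.
by rewrite ler_pdivrMr// mulrC ge_min lexx.
Qed.

(** * Passage to lower and upper limits, and to the random equation *)

Lemma limn_einf_ge (R : realType) (u : (\bar R)^nat) (l : \bar R) (N : nat) :
  (forall n, (N <= n)%N -> (l <= u n)%E) -> (l <= limn_einf u)%E.
Proof.
move=> lu; rewrite limn_einf_lim; apply: lime_ge; first exact: is_cvg_einfs.
exists N => // n /= Nn; apply: le_ereal_inf_tmp => _ [k /= nk <-].
exact/lu/(leq_trans Nn).
Qed.

Lemma limn_esup_le (R : realType) (u : (\bar R)^nat) (l : \bar R) (N : nat) :
  (forall n, (N <= n)%N -> (u n <= l)%E) -> (limn_esup u <= l)%E.
Proof.
move=> ul; rewrite limn_esup_lim; apply: lime_le; first exact: is_cvg_esups.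
exists N => // n /= Nn; apply: ge_ereal_sup => _ [k /= nk <-].
exact/ul/(leq_trans Nn).
Qed.

(** The density vanishes off [-1, 1], so each noise term leaves it with probability 0; countably
    many null sets are discarded. *)
Lemma noise_ae_bounded (R : realType) (d : measure_display)
    (T : measurableType d) (P : probability T R) (chi : nat -> {RV P >-> R})
    (phi : R -> R) :
  noise_assumption chi phi ->
  {ae P, forall w : T, forall n, chi n.+1 w \in `[-1, 1]}.
Proof.
move=> Hchi; apply: ae_foralln => n.
have [_ _ /(_ (~` `[-1, 1]))] := noise_density Hchi n.
have mI : measurable (~` `[-1, 1] : set R) by exact: measurableC.
rewrite integral0_eq => [/(_ mI) chi0|x /= /negP xI]; last first.
  by rewrite (noise_density_out Hchi).
exists (chi n.+1 @^-1` ~` `[-1, 1]); split => //.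
by rewrite -[X in measurable X]setTI; exact: measurable_funP.
Qed.

(* The hypothesis f_pos is needed: map_assumption lets f vanish at points beyond
   b, and if moreover f 0 = 0, then a solution can be absorbed at 0. *)
Theorem theorem3p4 (R : realType) (d : measure_display) (T : measurableType d)
    (P : probability T R) (chi : nat -> {RV P >-> R}) (phi : R -> R)
    (f : R -> R) (b xstar x0 ell : R)
    (Hf : map_assumption f b)
    (f_pos : f 0 = 0 -> forall x, b < x -> 0 < f x)
    (Hchi : noise_assumption chi phi)
    (Hxstar : xstar \in `]f 0, f b[)
    (Hx0 : 0 < x0) :
  let nu := Phi f (f_inv f b xstar) in
  0 < ell ->
  ell < Num.min (Phi f b - nu) (nu - Phi f 0) ->
  let x := pf_solution f nu ell chi x0 in
  let lo := Phi_inv f b (nu - ell) / (nu + ell) in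
  let hi := Phi_inv f b (nu + ell) / (nu - ell) in
  exists N : R -> nat,
    {ae P, forall w : T,
      (forall delta : R, 0 < delta ->
        forall n, (N delta <= n)%N -> x n w \in `]lo - delta, hi + delta[) /\
      (lo%:E <= limn_einf (fun n => (x n w)%:E))%E /\
      (limn_esup (fun n => (x n w)%:E) <= hi%:E)%E}.
Proof.
move=> nu ell0; rewrite lt_min => /andP[ellb ell0'] x lo hi.
have PA : Phi f 0 < nu - ell by lra.
have AB : nu - ell < nu + ell by lra.
have BP : nu + ell < Phi f b by lra.
(* N is obtained before any sample point w is fixed, hence is nonrandom. *)
have [N xN] := orbit_eventually_in Hf f_pos PA AB BP Hx0.
exists (fun=> N); apply: filterS (noise_ae_bounded Hchi) => w chiw.
have {}xN n : (N <= n)%N -> lo <= x n w <= hi.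
  apply: (xN (x ^~ w)) => // k; exists (nu + ell * chi k.+1 w) => //.
  by have := chiw k; rewrite in_itv /= => /andP[? ?]; apply/andP; split; nra.
split=> [delta delta0 n /xN /andP[? ?]|]; first by rewrite in_itv /=; lra.
split; [apply: (limn_einf_ge (N := N))|apply: (limn_esup_le (N := N))] => n Nn.
- by rewrite lee_fin; case/andP: (xN n Nn).
- by rewrite lee_fin; case/andP: (xN n Nn).
Qed.
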